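(* Let $\mathbf{F}\in[L^2(\mathbb{R}^2)]^2$ have compact support. Then $\mathbf{F}$ is uniquely determined by the multi-frequency far field data sets $$\mathcal{A}_p=\{u^\infty_{\mathbf{F},p}(\hat{\mathbf{x}},\omega):\ \hat{\mathbf{x}}\in\mathbb{S},\ \omega\in\mathbb{W}\}\quad\text{and}\quad \mathcal{A}_s=\{u^\infty_{\mathbf{F},s}(\hat{\mathbf{x}},\omega):\ \hat{\mathbf{x}}\in\mathbb{S},\ \omega\in\mathbb{W}\},$$ i.e., two compactly supported sources in $[L^2(\mathbb{R}^2)]^2$ having the same compressional and shear far field patterns for all $\hat{\mathbf{x}}\in\mathbb{S}$, $\omega\in\mathbb{W}$ coincide.
   Context: $\mathbb{W}=(\omega_{min},\omega_{max})$ with $0<\omega_{min}<\omega_{max}$; Lamé constants $\mu>0$, $2\mu+\lambda>0$; $k_p=\omega/\sqrt{\lambda+2\mu}$, $k_s=\omega/\sqrt\mu$. $\mathbb{S}$ is the unit circle and $\hat{\mathbf{x}}^\perp$ is $\hat{\mathbf{x}}$ rotated anticlockwise by $\pi/2$. The far field patterns of the source $\mathbf{F}$ (i.e., of the radiating solution of $\mu\Delta\mathbf{u}+(\lambda+\mu)\nabla\mathrm{div}\,\mathbf{u}+\omega^2\mathbf{u}=\mathbf{F}$) are $u^\infty_{\mathbf{F},p}(\hat{\mathbf{x}},\omega)=\int_{\mathbb{R}^2}e^{-ik_p\hat{\mathbf{x}}\cdot\mathbf{y}}\,\hat{\mathbf{x}}\cdot\mathbf{F}(\mathbf{y})\,d\mathbf{y}$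 and $u^\infty_{\mathbf{F},s}(\hat{\mathbf{x}},\omega)=\int_{\mathbb{R}^2}e^{-ik_s\hat{\mathbf{x}}\cdot\mathbf{y}}\,\hat{\mathbf{x}}^\perp\cdot\mathbf{F}(\mathbf{y})\,d\mathbf{y}$. *)

(* Defs.v *)
From HB Require Import structures.
From mathcomp Require Import all_boot all_order all_algebra.
From mathcomp Require Import all_classical all_reals all_analysis.
From mathcomp Require Import complex.
Set Implicit Arguments. Unset Strict Implicit. Unset Printing Implicit Defensive.
Import Order.TTheory GRing.Theory Num.Theory ComplexField.
Import numFieldNormedType.Exports.
Local Open Scope ring_scope.
Local Open Scope complex_scope.

Definition leb2 (R : realType) :=
  ((@lebesgue_measure R) \x (@lebesgue_measure R))%E.

Definition dot2 {R : realType} (a b : R * R) : R := a.1 * b.1 + a.2 * b.2.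

Definition on_circle {R : realType} (x : R * R) : Prop := dot2 x x = 1.

Definition perp {R : realType} (x : R * R) : R * R := (- x.2, x.1).

Definition source (R : realType) := R * R -> complex R * complex R.

Definition rdot {R : realType} (d : R * R) (v : complex R * complex R)
  : complex R := (d.1)%:C * v.1 + (d.2)%:C * v.2.

Definition cexpNi {R : realType} (t : R) : complex R :=
  (cos t)%:C - 'i * (sin t)%:C.

Definition far_int {R : realType} (k : R) (d e : R * R) (F : source R)
  : complex R :=
  let g := fun y : R * R => cexpNi (k * dot2 d y) * rdot e (F y) in
  (Rintegral (@leb2 R) setT (fun y => complex.Re (g y)))%:C
  + 'i * (Rintegral (@leb2 R) setT (fun y => complex.Im (g y)))%:C.

Definition kp {R : realType} (lam mu omega : R) : R :=
  omega / Num.sqrt (lam + 2 * mu).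
Definition ks {R : realType} (mu omega : R) : R := omega / Num.sqrt mu.

Definition farfield_p {R : realType} (lam mu : R) (F : source R)
  (xh : R * R) (omega : R) : complex R :=
  far_int (kp lam mu omega) xh xh F.
Definition farfield_s {R : realType} (mu : R) (F : source R)
  (xh : R * R) (omega : R) : complex R :=
  far_int (ks mu omega) xh (perp xh) F.

Definition L2_source {R : realType} (F : source R) : Prop :=
  [/\ measurable_fun setT (fun y => complex.Re (F y).1),
      measurable_fun setT (fun y => complex.Im (F y).1),
      measurable_fun setT (fun y => complex.Re (F y).2) &
      measurable_fun setT (fun y => complex.Im (F y).2)] /\
  [/\ (@leb2 R).-integrable setT (fun y => ((complex.Re (F y).1) ^+ 2)%:E),
      (@leb2 R).-integrable setT (fun y => ((complex.Im (F y).1) ^+ 2)%:E),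
      (@leb2 R).-integrable setT (fun y => ((complex.Re (F y).2) ^+ 2)%:E) &
      (@leb2 R).-integrable setT (fun y => ((complex.Im (F y).2) ^+ 2)%:E)].

(* compact support (for an L^2 class): F vanishes a.e. outside a compact set *)
Definition compact_support {R : realType} (F : source R) : Prop :=
  exists K : set (R * R), compact K /\
    {ae @leb2 R, forall y, ~ K y -> F y = (0, 0)}.

(* Main.v *)
Require Import Defs.
From HB Require Import structures.
From mathcomp Require Import all_boot all_order all_algebra.
From mathcomp Require Import all_classical all_reals all_analysis.
From mathcomp Require Import complex.
From mathcomp Require Import measurable_realfun ring lra.
Import Order.TTheory GRing.Theory Num.Theory ComplexField.
Import numFieldNormedType.Exports.
Local Open Scope ring_scope.
Local Open Scope classical_set_scope.
Set Implicit Arguments. Unset Strict Implicit. Unset Printing Implicit Defensive.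

(* On a square B carrying both supports let (h1, h2) = F - G. For a fixed
   direction x, the two far fields restrict to k |-> int e^{-ik x.y} x.(h1, h2)
   and the same with x^perp. Differentiating under the integral sign on the
   frequency band, and multiplying back by the Taylor polynomials of
   e^{ik0 x.y}, one gets int (x.y)^n x.(h1, h2) = 0 and
   int (x.y)^n x^perp.(h1, h2) = 0 for all n, hence int (x.y)^n hj = 0. Letting
   x vary and comparing coefficients, all moments int y1^m y2^n hj vanish.
   Explicit polynomials converging boundedly to indicators of half-lines then
   kill the integrals of hj over rectangles, and Dynkin's theorem gives hj = 0
   almost everywhere. *)

(** * Integrals against bounded and polynomial factors *)

Section bounded_multipliers.
Context {d} {T : measurableType d} {R : realType}.
Variables (mu : {measure set T -> \bar R}) (B : set T).
Hypothesis mB : measurable B.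

Lemma integrable_bounded_mul (f g : T -> R) (C : R) :
  measurable_fun B f -> (forall x, B x -> `|f x| <= C) ->
  mu.-integrable B (EFin \o g) ->
  mu.-integrable B (EFin \o (fun x => f x * g x)).
Proof.
move=> mf fC ig.
have := @integrableMr _ _ _ mu B mB f (EFin \o g) mf _ ig.
apply; exists C; split; first exact: num_real.
by move=> x Cx y By; apply: le_trans (fC y By) _; exact: ltW.
Qed.

Lemma integrable_lincomb (a b : R) (f g : T -> R) :
  mu.-integrable B (EFin \o f) -> mu.-integrable B (EFin \o g) ->
  mu.-integrable B (EFin \o (fun x => a * f x + b * g x)).
Proof.
move=> fi gi; rewrite (_ : _ \o _ = (fun x => (a%:E * (f x)%:E)%E) \+
                                    (fun x => (b%:E * (g x)%:E)%E)).
  by apply: integrableD => //; exact: integrableZl.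
exact/funext.
Qed.

Lemma integrable_subr (f g : T -> R) :
  mu.-integrable B (EFin \o f) -> mu.-integrable B (EFin \o g) ->
  mu.-integrable B (EFin \o (fun x => f x - g x)).
Proof. by move=> fi gi; exact: (integrableB mB fi gi). Qed.

Lemma integrable_mulX (s g : T -> R) (M : R) (n : nat) :
  measurable_fun B s -> (forall x, B x -> `|s x| <= M) ->
  mu.-integrable B (EFin \o g) ->
  mu.-integrable B (EFin \o (fun x => s x ^+ n * g x)).
Proof.
move=> ms sM; apply: (@integrable_bounded_mul _ _ (M ^+ n)).
  exact: measurable_funX.
by move=> x Bx; rewrite normrX lerXn2r// ?nnegrE// ?sM// (le_trans _ (sM x Bx)).
Qed.

(** Dominated convergence with majorant C|g|. It is applied with polynomials in a bounded function
    for [f_], and with an indicator, a cosine or a sine for the limit. *)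
Lemma Rintegral_cvg_mul0 (f_ : nat -> T -> R) (f g : T -> R) (C : R) :
  (forall n, measurable_fun B (f_ n)) ->
  (forall n x, B x -> `|f_ n x| <= C) ->
  (forall x, B x -> f_ ^~ x @ \oo --> f x) ->
  mu.-integrable B (EFin \o g) ->
  (forall n, \int[mu]_(x in B) (f_ n x * g x) = 0) ->
  \int[mu]_(x in B) (f x * g x) = 0.
Proof.
move=> mf_ f_C f_f ig f_0.
have mg : measurable_fun B g.
  by apply/measurable_EFinP; exact: measurable_int ig.
have mf : measurable_fun B f.
  by apply: measurable_fun_cvg f_f.
have := @dominated_convergence _ _ _ mu B mB
  (fun n x => (f_ n x * g x)%:E) (fun x => (f x * g x)%:E)
  (fun x => (C * `|g x|)%:E).
case.
- by move=> n; apply/measurable_EFinP/measurable_funM.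
- by apply/measurable_EFinP/measurable_funM.
- apply: aeW => x Bx; apply: cvg_EFin; first exact: nearW.
  by apply: cvgMl; exact: f_f.
- under eq_fun do rewrite EFinM.
  by apply: integrableZl => //; exact: integrable_norm.
- by apply: aeW => x n Bx; rewrite /= lee_fin normrM ler_wpM2r// f_C.
move=> intf _; rewrite -(fineK (integrable_fin_num mB intf)) => /fine_cvg h.
have h0 : (fun n => \int[mu]_(x in B) (f_ n x * g x)) = cst 0.
  by apply/funext => n; exact: f_0.
have {}h : cst (0 : R) @ \oo --> \int[mu]_(x in B) (f x * g x) by rewrite -h0.
by apply: (cvg_unique _ h) => //; exact: cvg_cst.
Qed.

Lemma integrable_horner_mul (s g : T -> R) (M : R) (p : {poly R}) :
  measurable_fun B s -> (forall x, B x -> `|s x| <= M) ->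
  mu.-integrable B (EFin \o g) ->
  mu.-integrable B (EFin \o (fun x => p.[s x] * g x)).
Proof.
move=> ms sM ig; elim/poly_ind: p => [|p c ih].
  rewrite (_ : _ \o _ = cst 0%E); first exact: integrable0.
  by apply/funext => x /=; rewrite horner0 mul0r.
rewrite (_ : _ \o _ = (fun x => (s x * (p.[s x] * g x))%:E) \+
                      (fun x => (c%:E * (g x)%:E)%E)); last first.
  by apply/funext => x /=; rewrite hornerMXaddC -EFinM -EFinD; congr EFin; ring.
apply: integrableD => //; last exact: integrableZl.
exact: (@integrable_bounded_mul _ _ M).
Qed.

Lemma Rintegral_horner_mul0 (s g : T -> R) (M : R) :
  measurable_fun B s -> (forall x, B x -> `|s x| <= M) ->
  mu.-integrable B (EFin \o g) ->
  (forall n, \int[mu]_(x in B) (s x ^+ n * g x) = 0) ->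
  forall p : {poly R}, \int[mu]_(x in B) (p.[s x] * g x) = 0.
Proof.
move=> ms sM ig g0 p.
(* The extra factor s^m makes the induction go through: peeling p into pX + c moves one power of s
   from the polynomial to this factor. *)
suff H m : \int[mu]_(x in B) (s x ^+ m * (p.[s x] * g x)) = 0.
  by have := H 0%N; under eq_Rintegral do rewrite expr0 mul1r.
elim/poly_ind: p m => [|p c ih] m.
  under eq_Rintegral do rewrite horner0 mul0r mulr0.
  by rewrite Rintegral_cst// mul0r.
transitivity (\int[mu]_(x in B) (s x ^+ m.+1 * (p.[s x] * g x) + c * (s x ^+ m * g x))).
  by apply: eq_Rintegral => x _; rewrite hornerMXaddC exprS; ring.
have ims k := integrable_mulX k ms sM ig.
have imp := integrable_mulX m.+1 ms sM (integrable_horner_mul p ms sM ig).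
rewrite RintegralD//; last first.
  rewrite (_ : _ \o _ = (fun x => (c%:E * (s x ^+ m * g x)%:E)%E)).
    exact: (integrableZl mB c (ims m)).
  by apply/funext => x.
by rewrite ih RintegralZl// g0 mulr0 addr0.
Qed.

End bounded_multipliers.

(** * Polynomials approximating a step function on [0, 1] *)

Section polynomial_step.
Context {R : realType}.
Implicit Types (a u : R).

Lemma bernoulli_ineq a m : -1 <= a -> 1 + m%:R * a <= (1 + a) ^+ m.
Proof.
move=> a1; elim: m => [|m ih]; first by rewrite mul0r addr0 expr0.
rewrite exprS; apply: (@le_trans _ _ ((1 + a) * (1 + m%:R * a))); last first.
  by rewrite ler_wpM2l//; lra.
rewrite -subr_ge0 -natr1.
rewrite (_ : _ - _ = m%:R * a ^+ 2); last by ring.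
by rewrite mulr_ge0// sqr_ge0.
Qed.

(* As n grows these polynomials tend on [0, 1] to the indicator of [0, 1/2[;
   the factor n+1 in the exponent settles the limit at 1/2 itself. *)
Definition step_poly (n : nat) : {poly R} :=
  (1 - 'X^(2 * n)) ^+ (n.+1 * 4 ^ n).

Lemma step_polyE n u :
  (step_poly n).[u] = (1 - u ^+ (2 * n)) ^+ (n.+1 * 4 ^ n).
Proof. by rewrite /step_poly horner_exp !hornerE. Qed.

Lemma step_poly_ge0 n u : 0 <= u <= 1 -> 0 <= (step_poly n).[u].
Proof.
by move=> /andP[u0 u1]; rewrite step_polyE exprn_ge0// subr_ge0 exprn_ile1.
Qed.

Lemma step_poly_le1 n u : 0 <= u <= 1 -> (step_poly n).[u] <= 1.
Proof.
move=> /andP[u0 u1]; rewrite step_polyE exprn_ile1//.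
  by rewrite subr_ge0 exprn_ile1.
by rewrite lerBlDr lerDl exprn_ge0.
Qed.

(** This is the quantity that Bernoulli's inequality produces. Written through 2u, it shows why the
    threshold is 1/2: powers of 2u decay below it and are at least 1 from it on. *)
Let step_exponent n u :
  (n.+1 * 4 ^ n)%:R * u ^+ (2 * n) = n.+1%:R * ((2 * u) ^+ n) ^+ 2.
Proof.
rewrite natrM natrX -exprM (mulnC n) exprMn -mulrA; congr (_ * (_ * _)).
by rewrite exprM; congr (_ ^+ _); ring.
Qed.

(** With w = 2u < 1, Bernoulli's inequality bounds the distance to 1 by (n+1) w^(2n). Since (n+1)
    w^n is bounded, this is at most a constant times w^n. *)
Lemma step_poly_cvg1 u : 0 <= u -> u < 2^-1 ->
  (step_poly n).[u] @[n --> \oo] --> (1 : R).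
Proof.
move=> u0 u12; set w := 2 * u.
have w0 : 0 <= w by rewrite /w; lra.
have w1 : w < 1 by rewrite /w; lra.
(* Each of the n+1 terms of the geometric sum 1 + w + ... + w^n is at least w^n. *)
have nw n : n.+1%:R * w ^+ n <= (1 - w)^-1.
  apply: (@le_trans _ _ (\sum_(i < n.+1) w ^+ i)).
    rewrite mulr_natl -[X in _ *+ X](card_ord n.+1) -sumr_const.
    apply: ler_sum => i _; rewrite ler_wiXn2l//; last by rewrite -ltnS.
    exact: ltW.
  rewrite -[leRHS]mul1r ler_pdivlMr; last by lra.
  have := subrX1 w n.+1; rewrite mulrC => /(congr1 -%R).
  rewrite -mulrN !opprB => <-.
  by rewrite lerBlDr lerDl exprn_ge0.
apply: (@squeeze_cvgr _ _ _ _ (fun n => 1 - (1 - w)^-1 * w ^+ n) (cst 1)).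
- apply: nearW => n; rewrite step_poly_le1 ?andbT; last by lra.
  rewrite step_polyE; apply: le_trans (bernoulli_ineq _ _); last first.
    by rewrite lerN2 exprn_ile1//; lra.
  rewrite mulrN step_exponent -/w lerD2l lerN2 expr2 mulrA ler_wpM2r//.
  exact: exprn_ge0.
- suff : 1 - (1 - w)^-1 * w ^+ n @[n --> \oo] --> 1 - (1 - w)^-1 * 0.
    by rewrite mulr0 subr0.
  apply: cvgB; first exact: cvg_cst.
  by apply: cvgMr; apply: cvg_expr; rewrite ger0_norm.
- exact: cvg_cst.
Qed.

(** Put a = u^(2n) and let m be the exponent. Then (1-a)^m (1+ma) <= (1-a)^m (1+a)^m = (1-a^2)^m <=
    1, while ma >= n+1 because 2u >= 1. So the value is at most 1/(n+1). *)
Lemma step_poly_cvg0 u : 2^-1 <= u -> u <= 1 ->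
  (step_poly n).[u] @[n --> \oo] --> (0 : R).
Proof.
move=> u12 u1.
have u0 : 0 <= u by lra.
apply: (@squeeze_cvgr _ _ _ _ (cst 0) (@harmonic R)).
- apply: nearW => n; rewrite step_poly_ge0 ?u0//=.
  rewrite step_polyE; set a := u ^+ (2 * n); set m := (n.+1 * 4 ^ n)%N.
  have a0 : 0 <= a by exact: exprn_ge0.
  have a1 : a <= 1 by exact: exprn_ile1.
  have ma : n.+1%:R <= m%:R * a.
    rewrite step_exponent -[leLHS]mulr1 ler_wpM2l// !exprn_ege1//; lra.
  have H : (1 - a) ^+ m * (1 + m%:R * a) <= 1.
    apply: (@le_trans _ _ ((1 - a) ^+ m * (1 + a) ^+ m)).
      rewrite ler_wpM2l ?bernoulli_ineq ?exprn_ge0//; lra.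
    rewrite -exprMn exprn_ile1//; nra.
  rewrite -[leRHS]mul1r ler_pdivlMr//; apply: le_trans H.
  by rewrite ler_wpM2l ?exprn_ge0//; lra.
- exact: cvg_cst.
- exact: cvg_harmonic.
Qed.

End polynomial_step.

(** * From vanishing moments to vanishing integrals over preimages *)

Section vanishing_moments.
Context {d} {T : measurableType d} {R : realType}.
Variables (mu : {measure set T -> \bar R}) (B : set T).
Hypothesis mB : measurable B.

(** The sets A whose preimage carries zero integral form a Dynkin class: the zero total integral
    handles complements, and countable additivity handles disjoint unions. It serves for half-lines
    on the line and, with s the identity, for rectangles in the plane. *)
Lemma Rintegral_preimage_dynkin d' (T' : measurableType d') (G : set (set T'))
    (s : T -> T') (g : T -> R) :
  @measurable _ T' = <<s G >> -> setI_closed G ->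
  measurable_fun B s -> mu.-integrable B (EFin \o g) ->
  \int[mu]_(x in B) g x = 0 ->
  (forall A, G A -> \int[mu]_(x in B `&` s @^-1` A) g x = 0) ->
  forall A, measurable A -> \int[mu]_(x in B `&` s @^-1` A) g x = 0.
Proof.
move=> mG IG ms ig g0 Gg0 A mA.
have mBs X : measurable X -> measurable (B `&` s @^-1` X) by move=> mX; exact: ms.
have iBs X : measurable X -> mu.-integrable (B `&` s @^-1` X) (EFin \o g).
  by move=> mX; apply: integrableS ig => //; exact: mBs.
(* Countable additivity is applied to extended real integrals. As [fine] sends infinities to 0,
   returning from a zero real integral takes the finiteness given by integrability. *)
have RE X : measurable X -> \int[mu]_(x in B `&` s @^-1` X) g x = 0 ->
    (\int[mu]_(x in B `&` s @^-1` X) (g x)%:E = 0)%E.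
  move=> mX gX; rewrite -[LHS]fineK ?integrable_fin_num//; last exact: iBs.
    by congr EFin.
  exact: mBs.
apply: (dynkin_induction (P := fun X => \int[mu]_(x in B `&` s @^-1` X) g x = 0)
  mG IG) => //.
- by rewrite preimage_setT setIT.
- move=> S mS gS; have mCS := measurableC mS.
  have : \int[mu]_(x in (B `&` s @^-1` S) `|` (B `&` s @^-1` (~` S))) g x = 0.
    by rewrite -setIUr -preimage_setU setUv preimage_setT setIT.
  rewrite Rintegral_setU ?gS ?add0r//; [exact: mBs|exact: mBs| |].
  + by rewrite -setIUr -preimage_setU setUv preimage_setT setIT.
  + by apply/disj_setPS => x [[_ +] [_ +]].
- move=> F mF tF gF.
  rewrite preimage_bigcup setI_bigcupr /Rintegral.
  have := @integral_bigcup _ _ _ mu (fun i => B `&` s @^-1` F i) (EFin \o g).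
  move=> ->.
  + by rewrite eseries0// => i _ _; exact: RE.
  + apply/trivIsetP => i j _ _ ij.
    move/trivIsetP : tF => /(_ i j I I ij) Fij.
    by rewrite setIACA setIid -preimage_setI Fij preimage_set0 setI0.
  + by move=> k; exact: mBs.
  + apply: integrableS ig => //.
      by apply: bigcupT_measurable => k; exact: mBs.
    by move=> x [k _ []].
- by rewrite -mG.
Qed.

Lemma measurable_horner (s : T -> R) (p : {poly R}) :
  measurable_fun B s -> measurable_fun B (fun x => p.[s x]).
Proof.
move=> ms; elim/poly_ind: p => [|p c ih].
  by under eq_fun do rewrite horner0; exact: measurable_cst.
under eq_fun do rewrite hornerMXaddC.
by apply: measurable_funD => //; exact: measurable_funM.
Qed.

Variables (s g : T -> R) (M : R).
Hypothesis ms : measurable_fun B s.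
Hypothesis sM : forall x, B x -> `|s x| <= M.
Hypothesis ig : mu.-integrable B (EFin \o g).
Hypothesis moments0 : forall n, \int[mu]_(x in B) (s x ^+ n * g x) = 0.

(** An affine change of variable carries the values of s on B into [0, 1] and t to 1/2. The step
    polynomials composed with it are polynomials in s, and they converge boundedly to the indicator
    of s < t. *)
Lemma Rintegral_halfline0 (t : R) :
  \int[mu]_(x in B `&` s @^-1` `]-oo, t[) g x = 0.
Proof.
(* A point of B is what forces M to be nonnegative. *)
have [->|/set0P[x0 Bx0]] := eqVneq B set0.
  by rewrite set0I Rintegral_set0.
have M0 : 0 <= M by rewrite (le_trans _ (sM Bx0)).
(* On B, |s - t| <= M + |t|, so c|s - t| <= 1/2; the summand 1 keeps the denominator positive. *)
set c := (2 * (M + `|t| + 1))^-1.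
have c0 : 0 < c by rewrite invr_gt0; have := normr_ge0 t; lra.
pose u x := 2^-1 + c * (s x - t).
have uB x : B x -> 0 <= u x <= 1.
  move=> /sM sx.
  have : `|c * (s x - t)| <= 2^-1.
    rewrite normrM (ger0_norm (ltW c0)) mulrC ler_pdivrMr; last first.
      by have := normr_ge0 t; lra.
    by rewrite (le_trans (ler_normB _ _))//; lra.
  by rewrite /u ler_norml; lra.
rewrite Rintegral_mkcondr.
transitivity (\int[mu]_(x in B) (\1_`]-oo, t[ (s x) * g x)).
  apply: eq_Rintegral => x _; rewrite patchE indicE.
  rewrite (_ : (x \in s @^-1` `]-oo, t[) = (s x \in `]-oo, t[%classic)).
    by case: ifPn; rewrite ?mul1r ?mul0r.
  by apply/idP/idP; rewrite !inE.
pose q : {poly R} := (2^-1 - c * t)%:P + c *: 'X.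
have qE x : q.[s x] = u x by rewrite /q /u !hornerE; ring.
apply: (@Rintegral_cvg_mul0 _ _ _ mu B mB
  (fun n x => (step_poly n \Po q).[s x]) _ _ 1) => //.
- by move=> n; exact: measurable_horner.
- move=> n x Bx; rewrite horner_comp qE ger0_norm ?step_poly_ge0 ?uB//.
  by rewrite step_poly_le1// uB.
- move=> x Bx; under eq_fun do rewrite horner_comp qE.
  have /andP[u0 u1] := uB _ Bx.
  rewrite indicE; have [xt|xt] := ltP (s x) t.
    rewrite mem_set/= ?in_itv//=; apply: step_poly_cvg1 => //.
    by rewrite /u gtrDl pmulr_rlt0// subr_lt0.
  rewrite memNset/= ?in_itv/=; last by apply/negP; rewrite -leNgt.
  apply: step_poly_cvg0 => //.
  by rewrite /u lerDl pmulr_rge0// subr_ge0.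
- by move=> n; apply: (Rintegral_horner_mul0 mB ms sM).
Qed.

(** Open lower half-lines generate the Borel sets and are stable under intersection, so Dynkin's
    theorem extends the previous lemma; the moment of order 0 gives the total integral. *)
Lemma Rintegral_preimage0 (A : set R) : measurable A ->
  \int[mu]_(x in B `&` s @^-1` A) g x = 0.
Proof.
apply: (@Rintegral_preimage_dynkin _ _ (@RGenInftyO.G R)) => //.
- exact: RGenInftyO.measurableE.
- move=> _ _ [x ->] [y ->]; exists (Num.min x y).
  apply/seteqP; split => z /=; rewrite !in_itv/= lt_min.
    by move=> [-> ->].
  by move=> /andP.
- by have := moments0 0; under eq_Rintegral do rewrite expr0 mul1r.
- by move=> _ [x ->]; exact: Rintegral_halfline0.
Qed.

End vanishing_moments.

(* [lebesgue_measure] lives on [measurableTypeR R], whose Borel sets are those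
   of [R] but whose display differs, so plane measures are stated over it. *)
Local Notation plane R := (measurableTypeR R * measurableTypeR R)%type.

Lemma measurable_fun_coord1 (R : realType) (B : set (plane R)) :
  measurable_fun B (fst : _ -> R).
Proof. by move=> mB Y mY; exact: (measurable_funTS measurable_fst mB). Qed.

Lemma measurable_fun_coord2 (R : realType) (B : set (plane R)) :
  measurable_fun B (snd : _ -> R).
Proof. by move=> mB Y mY; exact: (measurable_funTS measurable_snd mB). Qed.

(** * Functions on a bounded plane set with all mixed moments zero *)

Section plane_moments.
Context {R : realType}.
Variables (mu : {measure set (plane R) -> \bar R}) (B : set (plane R)) (M : R).
Hypothesis mB : measurable B.
Hypothesis B1 : forall y : R * R, B y -> `|y.1| <= M.
Hypothesis B2 : forall y : R * R, B y -> `|y.2| <= M.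

(** One coordinate is treated at a time. For fixed n, the moments in y1 of y2^n h vanish, hence so
    do its integrals over strips y1 in A. These are the moments in y2 of h on the strip, so h
    integrates to zero over rectangles, then over all measurable sets. *)
Lemma ae_eq0_moments (h : R * R -> R) :
  mu.-integrable B (EFin \o h) ->
  (forall m n, \int[mu]_(y in B) (y.1 ^+ m * (y.2 ^+ n * h y)) = 0) ->
  {ae mu, forall y, B y -> h y = 0}.
Proof.
move=> ih mh.
have m1 := @measurable_fun_coord1 R B.
have m2 := @measurable_fun_coord2 R B.
have H1 (A : set R) n : measurable A ->
    \int[mu]_(y in B `&` fst @^-1` A) (y.2 ^+ n * h y) = 0.
  apply: (Rintegral_preimage0 mB m1 B1) => //.
  exact: (integrable_mulX mB n m2 B2 ih).
have H2 (A C : set R) : measurable A -> measurable C ->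
    \int[mu]_(y in B `&` (A `*` C)) h y = 0.
  move=> mA mC.
  have mBA : measurable (B `&` fst @^-1` A) by exact: m1.
  rewrite (_ : B `&` _ = (B `&` fst @^-1` A) `&` snd @^-1` C); last first.
    by rewrite -setIA; congr (_ `&` _).
  apply: (@Rintegral_preimage0 _ _ _ mu _ mBA snd h M) => //.
  - exact: measurable_funS m2.
  - by move=> y [By _]; exact: B2.
  - exact: integrableS ih.
  - by move=> n; exact: H1.
have H3 E : measurable E -> \int[mu]_(y in B `&` E) h y = 0.
  apply: (@Rintegral_preimage_dynkin _ _ _ mu B mB _ _ _ id h
    (measurable_prod_measurableType _ _)) => //.
  - move=> _ _ [A1 mA1 [C1 mC1 <-]] [A2 mA2 [C2 mC2 <-]].
    exists (A1 `&` A2); first exact: measurableI.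
    by exists (C1 `&` C2); [exact: measurableI|rewrite setXI].
  - have := H2 setT setT measurableT measurableT.
    by rewrite setXTT setIT.
  - by move=> _ [A mA [C mC <-]]; exact: H2.
have : ae_eq mu B (EFin \o h) (cst 0%E).
  apply: integral_ae_eq => // E EB mE.
  rewrite integral0; have := H3 E mE; rewrite setIidr// => hE.
  rewrite -[LHS]fineK; first by congr EFin.
  by apply: integrable_fin_num => //; exact: integrableS ih.
by apply: filterS => y /= hy By; have [] := hy By.
Qed.

End plane_moments.

(** * Moments from oscillatory integrals on an interval of wavenumbers *)

Section analytic_continuation.
Context {d} {T : measurableType d} {R : realType}.
Variables (mu : {measure set T -> \bar R}) (B : set T) (s : T -> R) (M : R).
Hypothesis mB : measurable B.
Hypothesis ms : measurable_fun B s.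
Hypothesis sM : forall x, B x -> `|s x| <= M.

(** Each partial sum is a polynomial in s, so its integral against g vanishes. The factorial bound
    on the coefficients keeps all partial sums below one exponential, and dominated convergence
    gives the limit. *)
Lemma Rintegral_pseries_mul0 (c : nat -> R) (f : R -> R) (k : R) (g : T -> R) :
  (forall i, `|c i| <= (i`!%:R)^-1) ->
  (forall x : R, series (fun i => c i * x ^+ i) @ \oo --> f x) ->
  mu.-integrable B (EFin \o g) ->
  (forall n, \int[mu]_(x in B) (s x ^+ n * g x) = 0) ->
  \int[mu]_(x in B) (f (k * s x) * g x) = 0.
Proof.
move=> ci cf ig g0.
pose P n : {poly R} := \sum_(0 <= i < n) (c i * k ^+ i) *: 'X^i.
have PE n x : (P n).[s x] = series (fun i => c i * (k * s x) ^+ i) n.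
  rewrite /P horner_sum; apply: eq_bigr => i _.
  by rewrite hornerZ hornerXn exprMn mulrA.
(* The absolute value of M appears because M may be negative when B is empty. *)
apply: (@Rintegral_cvg_mul0 _ _ _ mu B mB (fun n x => (P n).[s x]) _ _
  (expR (`|k| * `|M|))) => //.
- by move=> n; exact: measurable_horner.
- move=> n x Bx; rewrite PE.
  apply: (@le_trans _ _ (series (exp_coeff (`|k| * `|M|)) n)).
    rewrite /series/= (le_trans (ler_norm_sum _ _ _))//.
    apply: ler_sum => i _; rewrite /exp_coeff/= normrM mulrC ler_pM//.
    rewrite normrX normrM lerXn2r ?nnegrE ?mulr_ge0// ler_wpM2l//.
    by rewrite (le_trans (sM Bx))// ler_norm.
  apply: nondecreasing_cvgn_le; last exact: is_cvg_series_exp_coeff.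
  apply: nondecreasing_series => i _ _; apply: exp_coeff_ge0.
  by rewrite mulr_ge0.
- by move=> x Bx; under eq_fun do rewrite PE; exact: cf.
- by move=> n; apply: (Rintegral_horner_mul0 mB ms sM).
Qed.

Lemma Rintegral_cos_mul0 (k : R) (g : T -> R) :
  mu.-integrable B (EFin \o g) ->
  (forall n, \int[mu]_(x in B) (s x ^+ n * g x) = 0) ->
  \int[mu]_(x in B) (cos (k * s x) * g x) = 0.
Proof.
move=> ig g0; apply: (Rintegral_pseries_mul0
  (c := fun n => (~~ odd n)%:R * (-1) ^+ n./2 * (n`!%:R)^-1)) => //.
- move=> i; rewrite normrM [`|_^-1|]ger0_norm// -[leRHS]mul1r ler_wpM2r//.
  by rewrite normrM normrX normrN1 expr1n mulr1; case: odd; rewrite ?normr0 ?normr1.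
- move=> x; rewrite unlock; have := @is_cvg_series_cos_coeff R x.
  by rewrite cos_coeffE.
Qed.

Lemma Rintegral_sin_mul0 (k : R) (g : T -> R) :
  mu.-integrable B (EFin \o g) ->
  (forall n, \int[mu]_(x in B) (s x ^+ n * g x) = 0) ->
  \int[mu]_(x in B) (sin (k * s x) * g x) = 0.
Proof.
move=> ig g0; apply: (Rintegral_pseries_mul0
  (c := fun n => (odd n)%:R * (-1) ^+ n.-1./2 * (n`!%:R)^-1)) => //.
- move=> i; rewrite normrM [`|_^-1|]ger0_norm// -[leRHS]mul1r ler_wpM2r//.
  by rewrite normrM normrX normrN1 expr1n mulr1; case: odd; rewrite ?normr0 ?normr1.
- move=> x; rewrite unlock; have := @is_cvg_series_sin_coeff R x.
  by rewrite sin_coeffE.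
Qed.

Lemma measurable_cos_mul (k : R) : measurable_fun B (fun x => cos (k * s x)).
Proof.
apply: measurableT_comp; last exact: measurable_funM.
by apply: continuous_measurable_fun; exact: continuous_cos.
Qed.

Lemma measurable_sin_mul (k : R) : measurable_fun B (fun x => sin (k * s x)).
Proof.
apply: measurableT_comp; last exact: measurable_funM.
by apply: continuous_measurable_fun; exact: continuous_sin.
Qed.

Lemma integrable_cos_mul (k : R) (g : T -> R) : mu.-integrable B (EFin \o g) ->
  mu.-integrable B (EFin \o (fun x => cos (k * s x) * g x)).
Proof.
apply: (@integrable_bounded_mul _ _ _ mu B mB _ _ 1).
  exact: measurable_cos_mul.
by move=> x _; exact: cos_max.
Qed.

Lemma integrable_sin_mul (k : R) (g : T -> R) : mu.-integrable B (EFin \o g) ->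
  mu.-integrable B (EFin \o (fun x => sin (k * s x) * g x)).
Proof.
apply: (@integrable_bounded_mul _ _ _ mu B mB _ _ 1).
  exact: measurable_sin_mul.
by move=> x _; exact: sin_max.
Qed.

Lemma integrable_trig (k : R) (a b : T -> R) :
  mu.-integrable B (EFin \o a) -> mu.-integrable B (EFin \o b) ->
  mu.-integrable B
    (EFin \o (fun x => cos (k * s x) * a x + sin (k * s x) * b x)).
Proof.
move=> ia ib; rewrite (_ : _ \o _ =
  (EFin \o (fun x => cos (k * s x) * a x)) \+
  (EFin \o (fun x => sin (k * s x) * b x))); last by apply/funext.
by apply: integrableD => //; [exact: integrable_cos_mul|exact: integrable_sin_mul].
Qed.

Variables u v : R.

(** A function of k that is zero on an open interval has zero derivative there. Differentiating in k
    replaces the pair (a, b) by (sb, -sa) and keeps the trigonometric form, so the step can be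
    iterated. The derivative is dominated by |M|(|a| + |b|). *)
Lemma Rintegral_trig_derive0 (a b : T -> R) :
  mu.-integrable B (EFin \o a) -> mu.-integrable B (EFin \o b) ->
  (forall k, u < k < v ->
    \int[mu]_(x in B) (cos (k * s x) * a x + sin (k * s x) * b x) = 0) ->
  forall k, u < k < v ->
    \int[mu]_(x in B)
      (cos (k * s x) * (s x * b x) + sin (k * s x) * - (s x * a x)) = 0.
Proof.
move=> ia ib ab0 k kuv.
pose f (l : R) x := cos (l * s x) * a x + sin (l * s x) * b x.
have df (l : R) x : is_derive l 1 (f ^~ x)
    (cos (l * s x) * (s x * b x) + sin (l * s x) * - (s x * a x)).
  rewrite /f; apply: trigger_derive.
  rewrite /GRing.scale/=; ring.
have Iuv l : `]u, v[%classic l -> u < l < v by rewrite /= in_itv.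
have kI : `]u, v[%classic k by rewrite /= in_itv.
have -> : \int[mu]_(x in B)
    (cos (k * s x) * (s x * b x) + sin (k * s x) * - (s x * a x)) =
    \int[mu]_(x in B) partial1of2 f k x.
  by apply: eq_Rintegral => x _; rewrite partial1of2E derive_val.
rewrite -(@differentiation_under_integral R _ _ mu f B mB k u v kI _ _
  (fun x => `|M| * (`|a x| + `|b x|))).
- rewrite derive1E (@near_eq_derive _ _ _ _ (cst 0)) ?derive_cst//.
  have := near_in_itvoo kI; apply: filterS => l /Iuv luv; exact: ab0.
- by move=> l _; exact: integrable_trig.
- by move=> l y _ _; exact: ex_derive.
- by move=> y; rewrite mulr_ge0// addr_ge0.
- rewrite (_ : _ \o _ = fun x => (`|M|%:E * ((`|a x|)%:E + (`|b x|)%:E))%E).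
    apply: integrableZl => //; apply: integrableD => //; exact: integrable_norm.
  by apply/funext => x.
- move=> l y _ By; rewrite partial1of2E derive_val.
  rewrite (le_trans (ler_normD _ _))// mulrDr addrC lerD// normrM.
    rewrite normrN -[leRHS]mul1r ler_pM// ?sin_max// normrM ler_wpM2r//.
    by rewrite (le_trans (sM By))// ler_norm.
  rewrite -[leRHS]mul1r ler_pM// ?cos_max// normrM ler_wpM2r//.
  by rewrite (le_trans (sM By))// ler_norm.
Qed.

(** The two hypotheses are the real and imaginary parts of the vanishing of the integral of
    e^{-iks}(p + iq). Derivatives in k insert powers of s; at one fixed k the factor e^{-iks} is
    then cancelled by the power series of e^{iks}. *)
Lemma Rintegral_trig_moments0 (p q : T -> R) :
  mu.-integrable B (EFin \o p) -> mu.-integrable B (EFin \o q) -> u < v ->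
  (forall k, u < k < v ->
    \int[mu]_(x in B) (cos (k * s x) * p x + sin (k * s x) * q x) = 0) ->
  (forall k, u < k < v ->
    \int[mu]_(x in B) (cos (k * s x) * q x + sin (k * s x) * - p x) = 0) ->
  forall n, \int[mu]_(x in B) (s x ^+ n * p x) = 0 /\
            \int[mu]_(x in B) (s x ^+ n * q x) = 0.
Proof.
move=> ip iq uv pq0 qp0 n.
have iX (h : T -> R) m : mu.-integrable B (EFin \o h) ->
    mu.-integrable B (EFin \o (fun x => s x ^+ m * h x)).
  exact: (integrable_mulX mB m ms sM).
have iN (h : T -> R) : mu.-integrable B (EFin \o h) ->
    mu.-integrable B (EFin \o (fun x => - h x)).
  by move=> /integrableN.
(* Both parts are carried together because each derivative brings down -is, which exchanges them up
   to sign. *)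
have H m : forall k, u < k < v ->
    \int[mu]_(x in B) (cos (k * s x) * (s x ^+ m * p x) +
                       sin (k * s x) * (s x ^+ m * q x)) = 0 /\
    \int[mu]_(x in B) (cos (k * s x) * (s x ^+ m * q x) +
                       sin (k * s x) * - (s x ^+ m * p x)) = 0.
  elim: m => [|m ih] k kuv.
    split; [rewrite -[RHS](pq0 k kuv)|rewrite -[RHS](qp0 k kuv)];
    by apply: eq_Rintegral => x _; rewrite expr0 !mul1r.
  have ihp l : u < l < v -> _ := fun luv => (ih l luv).1.
  have ihq l : u < l < v -> _ := fun luv => (ih l luv).2.
  split; last first.
    rewrite -[RHS](Rintegral_trig_derive0 (iX _ m ip) (iX _ m iq) ihp kuv).
    by apply: eq_Rintegral => x _; rewrite exprS !mulrA.
  (* The derivative of the imaginary part is minus the next real part, hence the multiplication by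
     -1. *)
  have := Rintegral_trig_derive0 (iX _ m iq) (iN _ (iX _ m ip)) ihq kuv.
  move=> /(congr1 ( *%R (-1))); rewrite mulr0 -RintegralZl//.
    move=> <-; apply: eq_Rintegral => x _; rewrite exprS; ring.
  apply: integrable_trig; last exact/iN/(@iX _ 1%N)/iX.
  exact/(@iX _ 1%N)/iN/iX.
pose k := (u + v) / 2.
have kuv : u < k < v by rewrite /k; lra.
(* [gr] and [gi] are the real and imaginary parts of e^{-iks}(p + iq). All moments of s^n [gr] and
   s^n [gi] vanish by [H]. *)
pose gr x := cos (k * s x) * p x + sin (k * s x) * q x.
pose gi x := cos (k * s x) * q x + sin (k * s x) * - p x.
have igr : mu.-integrable B (EFin \o gr) by exact: integrable_trig.
have igi : mu.-integrable B (EFin \o gi).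
  by apply: integrable_trig => //; exact: iN.
have gr0 m : \int[mu]_(x in B) (s x ^+ m * (s x ^+ n * gr x)) = 0.
  rewrite -[RHS](H (m + n)%N k kuv).1.
  by apply: eq_Rintegral => x _; rewrite /gr exprD; ring.
have gi0 m : \int[mu]_(x in B) (s x ^+ m * (s x ^+ n * gi x)) = 0.
  rewrite -[RHS](H (m + n)%N k kuv).2.
  by apply: eq_Rintegral => x _; rewrite /gi exprD; ring.
have cr := Rintegral_cos_mul0 k (iX _ n igr) gr0.
have sr := Rintegral_sin_mul0 k (iX _ n igr) gr0.
have ci := Rintegral_cos_mul0 k (iX _ n igi) gi0.
have si := Rintegral_sin_mul0 k (iX _ n igi) gi0.
have cs x := cos2Dsin2 (k * s x).
split.
(* Here and in the next case, p and q are recovered as the real and imaginary parts of e^{iks}([gr]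
   + i [gi]). *)
- transitivity (\int[mu]_(x in B) (cos (k * s x) * (s x ^+ n * gr x) -
                                  sin (k * s x) * (s x ^+ n * gi x))).
    apply: eq_Rintegral => x _; rewrite /gr /gi -[LHS]mul1r -(cs x); ring.
  rewrite RintegralB ?cr ?si ?subrr//.
    exact/integrable_cos_mul/iX.
  exact/integrable_sin_mul/iX.
- transitivity (\int[mu]_(x in B) (sin (k * s x) * (s x ^+ n * gr x) +
                                  cos (k * s x) * (s x ^+ n * gi x))).
    apply: eq_Rintegral => x _; rewrite /gr /gi -[LHS]mul1r -(cs x); ring.
  rewrite RintegralD ?sr ?ci ?addr0//.
    exact/integrable_sin_mul/iX.
  exact/integrable_cos_mul/iX.
Qed.

End analytic_continuation.

(** * Finite sums, restriction to a support, and square integrability *)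

Section support_and_sums.
Context {d} {T : measurableType d} {R : realType}.
Variables (mu : {measure set T -> \bar R}) (B : set T).
Hypothesis mB : measurable B.

Lemma Rintegral_sum_ord (N : nat) (f : nat -> T -> R) :
  (forall i, mu.-integrable B (EFin \o f i)) ->
  \int[mu]_(x in B) (\sum_(i < N) f i x) =
  \sum_(i < N) \int[mu]_(x in B) f i x.
Proof.
move=> fi; rewrite /Rintegral.
under eq_integral do rewrite -sumEFin.
rewrite (integral_sum mB (fun i : 'I_N => fi i)).
under eq_bigr do rewrite -(fineK (integrable_fin_num mB (fi _))).
by rewrite sumEFin.
Qed.

Lemma Rintegral_ae_support (f : T -> R) : measurable_fun setT f ->
  {ae mu, forall x, ~ B x -> f x = 0} ->
  \int[mu]_x f x = \int[mu]_(x in B) f x.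
Proof.
move=> mf f0; rewrite [RHS]Rintegral_mkcond; congr fine.
apply: ae_eq_integral => //.
- exact/measurable_EFinP.
- apply/measurable_EFinP; apply: (measurable_restrictT f mB).1.
  exact: measurable_funTS.
- apply: filterS f0 => x fx _; rewrite patchE; case: ifPn => //.
  by rewrite notin_setE => /fx ->.
Qed.

(** The majorant is 1 + f^2, whose constant term is integrable because B has finite measure. *)
Lemma integrable_sqr (f : T -> R) : (mu B < +oo)%E -> measurable_fun setT f ->
  mu.-integrable setT (fun x => (f x ^+ 2)%:E) ->
  mu.-integrable B (EFin \o f).
Proof.
move=> Boo mf if2.
apply: (@le_integrable _ _ _ mu B mB _
  ((fun=> (1 : R)%:E) \+ (fun x => (f x ^+ 2)%:E))).
- exact/measurable_EFinP/measurable_funTS.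
- move=> x _ /=; rewrite !lee_fin [leRHS]ger0_norm ?addr_ge0 ?sqr_ge0//.
  by rewrite -(real_normK (num_real (f x))); have := normr_ge0 (f x); nra.
- apply: integrableD => //; last exact: integrableS if2.
  apply: (measurable_bounded_integrable mB Boo (f := cst (1 : R))) => //.
  exact: bounded_cst.
Qed.

End support_and_sums.

(** * From moments along the directions (1, t) to mixed moments *)

Lemma coef0_of_horner0 (R : realType) (N : nat) (c : nat -> R) :
  (forall t, \sum_(i < N) c i * t ^+ i = 0) -> forall i, (i < N)%N -> c i = 0.
Proof.
move=> c0 i iN; pose p := \poly_(i < N) c i.
have p0 : p = 0.
  apply/eqP/negPn/negP => pn0.
  (* A nonzero p has fewer roots than its size, yet the naturals below [size p] are that many
     distinct roots. *)
  have := max_poly_roots (rs := [seq i%:R | i <- iota 0 (size p)]) pn0.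
  rewrite size_map size_iota ltnn => abs; suff : false by [].
  apply: abs; first by apply/allP => t _; rewrite rootE horner_poly c0.
  rewrite map_inj_uniq ?iota_uniq// => m n /eqP; rewrite eqr_nat.
  by move/eqP.
by have := coef_poly N c i; rewrite -/p p0 coef0 iN.
Qed.

(** For the total degree m + n, the binomial theorem makes the directional moment a polynomial in t
    whose coefficients are mixed moments times binomial coefficients. It vanishes for every t, and
    the coefficient of t^n is the wanted one. *)
Lemma plane_moments0 (R : realType) (mu : {measure set (plane R) -> \bar R})
    (B : set (plane R)) (M : R) (h : R * R -> R) :
  measurable B -> (forall y : R * R, B y -> `|y.1| <= M) ->
  (forall y : R * R, B y -> `|y.2| <= M) -> mu.-integrable B (EFin \o h) ->
  (forall (t : R) n, \int[mu]_(y in B) ((y.1 + t * y.2) ^+ n * h y) = 0) ->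
  forall m n, \int[mu]_(y in B) (y.1 ^+ m * (y.2 ^+ n * h y)) = 0.
Proof.
move=> mB B1 B2 ih h0 m n.
have m1 := @measurable_fun_coord1 R B.
have m2 := @measurable_fun_coord2 R B.
pose I k l := \int[mu]_(y in B) (y.1 ^+ k * (y.2 ^+ l * h y)).
have iI k l : mu.-integrable B
    (EFin \o (fun y : R * R => y.1 ^+ k * (y.2 ^+ l * h y))).
  exact/(integrable_mulX mB k m1 B1)/(integrable_mulX mB l m2 B2).
pose c i := 'C(m + n, i)%:R * I (m + n - i)%N i.
have : c n = 0.
  apply: (@coef0_of_horner0 R (m + n).+1 c); last by rewrite ltnS leq_addl.
  move=> t; rewrite -[RHS](h0 t (m + n)%N).
  under [RHS]eq_Rintegral do rewrite exprDn mulr_suml.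
  rewrite (@Rintegral_sum_ord _ _ _ mu B mB (m + n).+1 (fun i y =>
    y.1 ^+ (m + n - i) * (t * y.2) ^+ i *+ 'C(m + n, i) * h y)).
    apply: eq_bigr => i _; rewrite /c /I mulrAC -RintegralZl//.
    by apply: eq_Rintegral => y _; rewrite exprMn -mulr_natl; ring.
  move=> i; rewrite (_ : _ \o _ = fun y => (('C(m + n, i)%:R * t ^+ i)%:E *
      (y.1 ^+ (m + n - i) * (y.2 ^+ i * h y))%:E)%E).
    exact: (integrableZl mB _ (iI _ _)).
  apply/funext => y /=; rewrite -EFinM; congr EFin.
  by rewrite exprMn -mulr_natl; ring.
rewrite /c addnK => /eqP; rewrite mulf_eq0 pnatr_eq0 => /orP[|/eqP//].
by rewrite -leqn0 leqNgt bin_gt0 leq_addl.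
Qed.

(** * Longitudinal and transverse moments over the unit circle *)

Section directional_moments.
Context {R : realType}.
Variables (mu : {measure set (plane R) -> \bar R}) (B : set (plane R)) (M : R).
Hypothesis mB : measurable B.
Hypothesis B1 : forall y : R * R, B y -> `|y.1| <= M.
Hypothesis B2 : forall y : R * R, B y -> `|y.2| <= M.

Lemma measurable_dot2 (x : R * R) : measurable_fun B (dot2 x).
Proof.
by apply: measurable_funD; apply: measurable_funM => //; exact: measurable_funTS.
Qed.

Lemma dot2_bounded (x y : R * R) : B y ->
  `|dot2 x y| <= `|x.1| * M + `|x.2| * M.
Proof.
move=> By; rewrite /dot2 (le_trans (ler_normD _ _))// !normrM.
by rewrite lerD// ler_wpM2l// ?B1 ?B2.
Qed.

(** For a unit x the pair x, [perp x] is orthonormal, so the longitudinal and transverse moments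
    with the same weight (x.y)^n together give those of each component. *)
Lemma ae_eq0_directional_moments (h1 h2 : R * R -> R) :
  mu.-integrable B (EFin \o h1) -> mu.-integrable B (EFin \o h2) ->
  (forall x, on_circle x -> forall n,
    \int[mu]_(y in B) (dot2 x y ^+ n * (x.1 * h1 y + x.2 * h2 y)) = 0) ->
  (forall x, on_circle x -> forall n, \int[mu]_(y in B)
    (dot2 x y ^+ n * ((perp x).1 * h1 y + (perp x).2 * h2 y)) = 0) ->
  {ae mu, forall y, B y -> h1 y = 0} /\ {ae mu, forall y, B y -> h2 y = 0}.
Proof.
move=> ih1 ih2 hl ht.
have iX x a b n : mu.-integrable B
    (EFin \o (fun y => dot2 x y ^+ n * (a * h1 y + b * h2 y))).
  apply: (integrable_mulX mB n (measurable_dot2 x) (dot2_bounded x)).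
  exact: integrable_lincomb.
have comb x (a b : R) n : on_circle x ->
    \int[mu]_(y in B) (dot2 x y ^+ n *
      (a * (x.1 * h1 y + x.2 * h2 y) +
       b * ((perp x).1 * h1 y + (perp x).2 * h2 y))) = 0.
  move=> xS; transitivity (\int[mu]_(y in B)
    (a * (dot2 x y ^+ n * (x.1 * h1 y + x.2 * h2 y)) +
     b * (dot2 x y ^+ n * ((perp x).1 * h1 y + (perp x).2 * h2 y)))).
    by apply: eq_Rintegral => y _; ring.
  rewrite RintegralD//; last 2 first.
  - exact: (integrableZl mB a (iX _ _ _ _)).
  - exact: (integrableZl mB b (iX _ _ _ _)).
  by rewrite !RintegralZl// hl// ht// !mulr0 addr0.
have slope (h : R * R -> R) : mu.-integrable B (EFin \o h) ->
    (forall x, on_circle x -> forall n,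
      \int[mu]_(y in B) (dot2 x y ^+ n * h y) = 0) ->
    {ae mu, forall y, B y -> h y = 0}.
  move=> ih h0; apply: (ae_eq0_moments mB B1 B2 ih).
  apply: (plane_moments0 mB B1 B2 ih) => t n.
  (* Dividing (1, t) by its length r gives a point of the circle; homogeneity of degree n brings the
     moment back to (1, t) through the factor r^n. *)
  have r0 : 0 < Num.sqrt (1 + t ^+ 2).
    by rewrite sqrtr_gt0; have := sqr_ge0 t; lra.
  set r := Num.sqrt _ in r0.
  have rr : r ^+ 2 = 1 + t ^+ 2.
    by rewrite sqr_sqrtr//; have := sqr_ge0 t; lra.
  have xS : on_circle (r^-1, t / r).
    rewrite /on_circle /dot2/=.
    have -> : r^-1 * r^-1 + t / r * (t / r) = (1 + t ^+ 2) / r ^+ 2.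
      by field; rewrite gt_eqF.
    by rewrite rr divff// -rr sqrf_eq0 gt_eqF.
  have /(congr1 ( *%R (r ^+ n))) := h0 _ xS n.
  rewrite mulr0 -RintegralZl//; last first.
    exact: (integrable_mulX mB n (measurable_dot2 _) (dot2_bounded _)).
  move=> <-; apply: eq_Rintegral => y _; rewrite mulrA -exprMn.
  by congr (_ ^+ _ * _); rewrite /dot2/=; field; rewrite gt_eqF.
(* The coefficients come from (1, 0) = x1 x - x2 x^perp and (0, 1) = x2 x + x1 x^perp. *)
split; apply: slope => // x xS n.
- rewrite -[RHS](comb x x.1 (- x.2) n xS); apply: eq_Rintegral => y _.
  by rewrite -[h1 y in LHS]mul1r -xS /perp /dot2/=; congr (_ * _); ring.
- rewrite -[RHS](comb x x.2 x.1 n xS); apply: eq_Rintegral => y _.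
  by rewrite -[h2 y in LHS]mul1r -xS /perp /dot2/=; congr (_ * _); ring.
Qed.

End directional_moments.

(** * Far fields as real integrals over a square *)

Section far_field.
Context {R : realType}.
Implicit Types (F G : source R) (e x : R * R).

Definition leb2_measure : {measure set (plane R) -> \bar R} :=
  [the {measure set _ -> \bar R} of
    (@lebesgue_measure R \x @lebesgue_measure R)%E].
Local Notation mu := leb2_measure.

Definition redot e F (y : R * R) : R :=
  e.1 * complex.Re (F y).1 + e.2 * complex.Re (F y).2.

Definition imdot e F (y : R * R) : R :=
  e.1 * complex.Im (F y).1 + e.2 * complex.Im (F y).2.

(** Expanding e^{-ikx.y} times e.F gives the pair of integrands that [Rintegral_trig_moments0] takes
    as hypotheses. *)
Lemma far_intE (k : R) x e F : far_int k x e F =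
  Complex
    (\int[mu]_y
      (cos (k * dot2 x y) * redot e F y + sin (k * dot2 x y) * imdot e F y))
    (\int[mu]_y
      (cos (k * dot2 x y) * imdot e F y + sin (k * dot2 x y) * - redot e F y)).
Proof.
rewrite /far_int.
have -> : (fun y => complex.Re (cexpNi (k * dot2 x y) * rdot e (F y))) =
  (fun y => cos (k * dot2 x y) * redot e F y + sin (k * dot2 x y) * imdot e F y).
  apply/funext => y; rewrite /cexpNi /rdot /redot /imdot.
  by case: (F y) => [[a b] [c d]] /=; ring.
have -> : (fun y => complex.Im (cexpNi (k * dot2 x y) * rdot e (F y))) =
  (fun y => cos (k * dot2 x y) * imdot e F y + sin (k * dot2 x y) * - redot e F y).
  apply/funext => y; rewrite /cexpNi /rdot /redot /imdot.
  by case: (F y) => [[a b] [c d]] /=; ring.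
by apply/eqP; rewrite eq_complex/=; apply/andP; split; apply/eqP;
  rewrite /leb2_measure /leb2; ring.
Qed.

Definition square (M : R) : set (plane R) := `[- M, M] `*` `[- M, M].

Lemma measurable_square M : measurable (square M).
Proof. by apply: measurableX; exact: measurable_itv. Qed.

Lemma square1 M y : square M y -> `|y.1| <= M.
Proof. by move=> [+ _]; rewrite /= in_itv/= ler_norml. Qed.

Lemma square2 M y : square M y -> `|y.2| <= M.
Proof. by move=> [_ +]; rewrite /= in_itv/= ler_norml. Qed.

Lemma square_finite M : (mu (square M) < +oo)%E.
Proof.
have -> : mu (square M) =
    (@lebesgue_measure R `[(- M)%R, M] * @lebesgue_measure R `[(- M)%R, M])%E.
  exact: product_measure1E.
rewrite lebesgue_measure_itv/=; case: ifP => _; rewrite ?mul0e//.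
by rewrite -!EFinD -EFinM ltry.
Qed.

(** All large squares are provided, so that two sources can share one. The norm on the product is
    the maximum norm, whose balls are squares. *)
Lemma compact_supportP F : compact_support F ->
  exists M0 : R, forall M, M0 < M ->
    {ae mu, forall y, ~ square M y -> F y = (0, 0)}.
Proof.
move=> [K [/compact_bounded[M0 [_ KM0]] F0]].
exists M0 => M /KM0 KM.
apply: (@filterS _ _ (ae_filter_ringOfSetsType mu) _ _ _ F0) => y Fy nB.
apply: Fy => Ky.
apply: nB; have := KM _ Ky; rewrite /square /= prod_normE ge_max.
by move=> /andP[y1 y2]; split; rewrite /= in_itv/= -ler_norml.
Qed.

Variable M : R.
Local Notation B := (square M).
Let mB := measurable_square M.

Lemma measurable_lincomb (a b : R) (f g : plane R -> R) :
  measurable_fun setT f -> measurable_fun setT g ->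
  measurable_fun setT (fun y => a * f y + b * g y).
Proof. by move=> mf mg; apply: measurable_funD; exact: measurable_funM. Qed.

Lemma L2_source_integrable F : L2_source F ->
  [/\ mu.-integrable B (EFin \o (fun y => complex.Re (F y).1)),
      mu.-integrable B (EFin \o (fun y => complex.Im (F y).1)),
      mu.-integrable B (EFin \o (fun y => complex.Re (F y).2)) &
      mu.-integrable B (EFin \o (fun y => complex.Im (F y).2))].
Proof.
have key (f : plane R -> R) := @integrable_sqr _ _ _ mu B mB f (square_finite M).
by move=> [[? ? ? ?] [? ? ? ?]]; split; apply: key.
Qed.

Lemma L2_source_redot e F : L2_source F ->
  mu.-integrable B (EFin \o redot e F).
Proof. by move=> /L2_source_integrable[? ? ? ?]; exact: integrable_lincomb. Qed.

Lemma L2_source_imdot e F : L2_source F ->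
  mu.-integrable B (EFin \o imdot e F).
Proof. by move=> /L2_source_integrable[? ? ? ?]; exact: integrable_lincomb. Qed.

Lemma measurable_redot e F : L2_source F ->
  measurable_fun setT (redot e F : plane R -> R).
Proof. by move=> [[? ? ? ?] _]; exact: measurable_lincomb. Qed.

Lemma measurable_imdot e F : L2_source F ->
  measurable_fun setT (imdot e F : plane R -> R).
Proof. by move=> [[? ? ? ?] _]; exact: measurable_lincomb. Qed.

Definition supported F := {ae mu, forall y, ~ B y -> F y = (0, 0)}.

Lemma Rintegral_trig_supported (k : R) x F (f g : plane R -> R) :
  measurable_fun setT f -> measurable_fun setT g -> supported F ->
  (forall y, F y = (0, 0) -> f y = 0 /\ g y = 0) ->
  \int[mu]_y (cos (k * dot2 x y) * f y + sin (k * dot2 x y) * g y) =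
  \int[mu]_(y in B) (cos (k * dot2 x y) * f y + sin (k * dot2 x y) * g y).
Proof.
move=> mf mg sF F0; apply: Rintegral_ae_support => //.
  apply: measurable_funD; apply: measurable_funM => //.
    by apply: measurable_cos_mul; exact: measurable_dot2.
  by apply: measurable_sin_mul; exact: measurable_dot2.
apply: (@filterS _ _ (ae_filter_ringOfSetsType mu) _ _ _ sF) => y Fy nB.
by have [-> ->] := F0 _ (Fy nB); rewrite !mulr0 addr0.
Qed.

Lemma far_int_supported (k : R) x e F : L2_source F -> supported F ->
  far_int k x e F = Complex
    (\int[mu]_(y in B)
      (cos (k * dot2 x y) * redot e F y + sin (k * dot2 x y) * imdot e F y))
    (\int[mu]_(y in B)
      (cos (k * dot2 x y) * imdot e F y + sin (k * dot2 x y) * - redot e F y)).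
Proof.
move=> L2F sF; rewrite far_intE; congr Complex.
  apply: (Rintegral_trig_supported _ _ _ _ sF).
  - exact: measurable_redot.
  - exact: measurable_imdot.
  - by move=> y Fy; rewrite /redot /imdot Fy/= !mulr0 addr0.
apply: (Rintegral_trig_supported (g := fun y => - redot e F y) _ _ _ _ sF).
- exact: measurable_imdot.
- exact: (measurable_funN (measurable_redot e L2F)).
- by move=> y Fy; rewrite /redot /imdot Fy/= !mulr0 addr0 oppr0.
Qed.

End far_field.

(** * Uniqueness of the source from its wavenumber data *)

Section uniqueness.
Context {R : realType}.
Variables (M : R) (F G : source R).
Local Notation mu := (@leb2_measure R).
Local Notation B := (square M).
Hypotheses (L2F : L2_source F) (L2G : L2_source G).
Hypotheses (sF : supported M F) (sG : supported M G).

(** By linearity, equal far fields make the oscillatory integrals of e.(F - G) vanish. The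
    polarisation e is left free to serve as both x and [perp x]. *)
Lemma far_int_moments0 x e (u v : R) : u < v ->
  (forall k, u < k < v -> far_int k x e F = far_int k x e G) ->
  forall n,
    \int[mu]_(y in B) (dot2 x y ^+ n * (redot e F y - redot e G y)) = 0 /\
    \int[mu]_(y in B) (dot2 x y ^+ n * (imdot e F y - imdot e G y)) = 0.
Proof.
move=> uv FG; have mB := measurable_square M.
have mx := measurable_dot2 (B := B) x.
have irF := L2_source_redot M e L2F; have irG := L2_source_redot M e L2G.
have iiF := L2_source_imdot M e L2F; have iiG := L2_source_imdot M e L2G.
have iN (h : plane R -> R) : mu.-integrable B (EFin \o h) ->
    mu.-integrable B (EFin \o (fun y => - h y)) by move=> /integrableN.
apply: (Rintegral_trig_moments0 mB mx (dot2_bounded (@square1 _ M)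
  (@square2 _ M) x) _ _ uv) => [||k /FG|k /FG]; [exact: integrable_subr|exact: integrable_subr| |];
  rewrite !(far_int_supported _ _ _ _ _ (M := M))// => -[re im].
- move/eqP : re; rewrite -subr_eq0 -RintegralB//; last 2 first.
  + exact: (integrable_trig mB mx).
  + exact: (integrable_trig mB mx).
  by move=> /eqP <-; apply: eq_Rintegral => y _; ring.
- move/eqP : im; rewrite -subr_eq0 -RintegralB//; last 2 first.
  + by apply: (integrable_trig mB mx) => //; exact: iN.
  + by apply: (integrable_trig mB mx) => //; exact: iN.
  by move=> /eqP <-; apply: eq_Rintegral => y _; ring.
Qed.

(** The two wave types have different speeds, so one frequency band yields two wavenumber intervals.
    This does no harm, since the moments extracted from them no longer involve the wavenumber and
    can be combined. *)
Lemma source_unique (u v u' v' : R) : u < v -> u' < v' ->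
  (forall x k, on_circle x -> u < k < v ->
    far_int k x x F = far_int k x x G) ->
  (forall x k, on_circle x -> u' < k < v' ->
    far_int k x (perp x) F = far_int k x (perp x) G) ->
  {ae mu, forall y, F y = G y}.
Proof.
move=> uv uv' hp hs; have mB := measurable_square M.
have [rF1 iF1 rF2 iF2] := L2_source_integrable M L2F.
have [rG1 iG1 rG2 iG2] := L2_source_integrable M L2G.
have mp x n xS := far_int_moments0 uv (fun k => hp x k xS) n.
have mt x n xS := far_int_moments0 uv' (fun k => hs x k xS) n.
have [r1 r2] : {ae mu, forall y, B y ->
      complex.Re (F y).1 - complex.Re (G y).1 = 0} /\
    {ae mu, forall y, B y -> complex.Re (F y).2 - complex.Re (G y).2 = 0}.
  apply: (ae_eq0_directional_moments mB (@square1 _ M) (@square2 _ M)).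
  - exact: integrable_subr.
  - exact: integrable_subr.
  - move=> x xS n; rewrite -[RHS](mp x n xS).1.
    by apply: eq_Rintegral => y _; rewrite /redot; ring.
  - move=> x xS n; rewrite -[RHS](mt x n xS).1.
    by apply: eq_Rintegral => y _; rewrite /redot; ring.
have [i1 i2] : {ae mu, forall y, B y ->
      complex.Im (F y).1 - complex.Im (G y).1 = 0} /\
    {ae mu, forall y, B y -> complex.Im (F y).2 - complex.Im (G y).2 = 0}.
  apply: (ae_eq0_directional_moments mB (@square1 _ M) (@square2 _ M)).
  - exact: integrable_subr.
  - exact: integrable_subr.
  - move=> x xS n; rewrite -[RHS](mp x n xS).2.
    by apply: eq_Rintegral => y _; rewrite /imdot; ring.
  - move=> x xS n; rewrite -[RHS](mt x n xS).2.
    by apply: eq_Rintegral => y _; rewrite /imdot; ring.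
have aeI P Q : {ae mu, forall y, P y} -> {ae mu, forall y, Q y} ->
    {ae mu, forall y, P y /\ Q y}.
  exact: (@filterI _ _ (ae_filter_ringOfSetsType mu)).
have H := aeI _ _ (aeI _ _ (aeI _ _ r1 r2) (aeI _ _ i1 i2)) (aeI _ _ sF sG).
apply: (@filterS _ _ (ae_filter_ringOfSetsType mu) _ _ _ H).
move=> y [[[h1 h2] [h3 h4]] [h5 h6]].
have [By|nBy] := pselect (B y); last by rewrite h5// h6.
move: (h1 By) (h2 By) (h3 By) (h4 By).
case: (F y) => [[a b] [c d]]; case: (G y) => [[a' b'] [c' d']] /=.
by do 4 move=> /subr0_eq ->.
Qed.

End uniqueness.

Theorem theorem3p1 (R : realType) (lam mu wmin wmax : R)
  (hmu : 0 < mu) (hlm : 0 < 2 * mu + lam)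
  (hw0 : 0 < wmin) (hw : wmin < wmax)
  (F G : source R)
  (hF : L2_source F) (hG : L2_source G)
  (hFc : compact_support F) (hGc : compact_support G)
  (hp : forall xh omega, on_circle xh -> wmin < omega < wmax ->
          farfield_p lam mu F xh omega = farfield_p lam mu G xh omega)
  (hs : forall xh omega, on_circle xh -> wmin < omega < wmax ->
          farfield_s mu F xh omega = farfield_s mu G xh omega) :
  {ae @leb2 R, forall y, F y = G y}.
Proof.
have [MF sF] := compact_supportP hFc; have [MG sG] := compact_supportP hGc.
(* Adding 1 puts M strictly above both thresholds. *)
pose M := Num.max MF MG + 1.
have sp : 0 < Num.sqrt (lam + 2 * mu) by rewrite sqrtr_gt0 addrC.
have ss : 0 < Num.sqrt mu by rewrite sqrtr_gt0.
(* With c the wave speed, a wavenumber k corresponds to the frequency kc. *)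
have rescale (c k : R) : 0 < c ->
    (wmin / c < k < wmax / c) = (wmin < k * c < wmax).
  by move=> c0; rewrite ltr_pdivrMr// ltr_pdivlMr.
apply: (@source_unique R M F G hF hG _ _ (wmin / Num.sqrt (lam + 2 * mu))
  (wmax / Num.sqrt (lam + 2 * mu)) (wmin / Num.sqrt mu) (wmax / Num.sqrt mu)).
- by apply: sF; rewrite /M ltr_pwDr// le_max lexx.
- by apply: sG; rewrite /M ltr_pwDr// le_max lexx orbT.
- by rewrite ltr_pM2r// invr_gt0.
- by rewrite ltr_pM2r// invr_gt0.
- move=> x k xS; rewrite rescale// => /(hp _ _ xS).
  by rewrite /farfield_p /kp mulfK// gt_eqF.
- move=> x k xS; rewrite rescale// => /(hs _ _ xS).
  by rewrite /farfield_s /ks mulfK// gt_eqF.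
Qed.
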